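(* Let $R$ be a finite local commutative ring, $K\le R^\times$ a pure group, $\mathcal C=\mathrm{Cyc}(K,R)$, $I_0=\{x\in\mathrm{rad}(R): x\,\mathrm{rad}(R)=\{0\}\}$ and $E_0$ the equivalence relation on $R$ whose classes are the cosets of $I_0$. Then the natural mapping $\mathrm{Aut}_{\mathcal C}(R)\to\mathrm{Aut}_{\mathcal C}(R/I_0)$ is a monomorphism. Moreover, $\mathrm{Aut}(\mathcal C)\le\mathrm{A\Gamma L}_1(R)$ whenever $\mathrm{Aut}(\mathcal C)^{R/E_0}\le\mathrm{A\Gamma L}_1(R/I_0)$.
   Context: All rings have an identity; $\mathrm{rad}(R)$ is the maximal ideal of the local ring $R$. $\mathrm{Cyc}(K,R)$ is the pair $(R,\mathrm{Rel}(K,R))$ with $\mathrm{Rel}(K,R)$ the relations $\{(x,y): y-x\in rK\}$, $r\in R$; $\mathrm{Aut}(\mathcal C)$ is the group of permutations of $R$ fixing each such relation. $\mathrm{A\Gamma L}_1(S)$, for a ring $S$, is the group of permutations $x\mapsto ax^\sigma+b$, $a\in S^\times$, $b\in S$, $\sigma\in\mathrm{Aut}(S)$. A group $K$ is pure if the only ideal $I$ with $1+I\subseteq K$ is $\{0\}$. The equivalence $E_0$ is $\mathrm{Aut}(\mathcal C)$-invariant, and $\mathrm{Aut}(\mathcal C)^{R/E_0}$ denotes the group of permutations of $R/E_0=R/I_0$ induced by $\mathrm{Aut}(\mathcal C)$. $\mathrm{Aut}_{\mathcal C}(R)=\mathrm{Aut}(\mathcal C)\cap\mathrm{Aut}(R)$.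 The quotient scheme of $\mathcal C$ modulo $E_0$ is the cyclotomic scheme $\mathrm{Cyc}(\pi_0(K),R/I_0)$, $\pi_0:R\to R/I_0$ the natural epimorphism, and $\mathrm{Aut}_{\mathcal C}(R/I_0)=\mathrm{Aut}(\mathrm{Cyc}(\pi_0(K),R/I_0))\cap\mathrm{Aut}(R/I_0)$. The natural mapping sends $\sigma\in\mathrm{Aut}_{\mathcal C}(R)$ to the automorphism of $R/I_0$ it induces. *)

(* Defs.v *)
From HB Require Import structures.
From mathcomp Require Import all_boot all_order all_algebra all_fingroup.
From mathcomp Require Import generic_quotient ring_quotient.

Set Implicit Arguments.
Unset Strict Implicit.
Unset Printing Implicit Defensive.

Import GRing.Theory.
Local Open Scope ring_scope.

Section FinRingIdeals.
Variable R : finComUnitRingType.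

Definition is_ideal (I : {set R}) : bool :=
  [&& 0 \in I,
      [forall x in I, forall y in I, x - y \in I] &
      [forall a : R, forall x in I, a * x \in I]].

Definition maximal_ideal (M : {set R}) : bool :=
  [&& is_ideal M, 1 \notin M &
      [forall J : {set R}, (is_ideal J && (M \proper J)) ==> (1 \in J)]].

Definition is_local : Prop :=
  exists M : {set R}, maximal_ideal M /\ forall M', maximal_ideal M' -> M' = M.

Definition rad : {set R} := \bigcap_(M | maximal_ideal M) M.

Definition I0 : {pred R} :=
  fun x => (x \in rad) && [forall y in rad, x * y == 0].

Lemma rad_closed : 0 \in rad /\ (forall a u v, u \in rad -> v \in rad -> a * u + v \in rad).
Proof.
split.
  by apply/bigcapP => M /and3P [/and3P [] ].
move=> a u v /bigcapP Hu /bigcapP Hv; apply/bigcapP => M HM.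
have := HM; case/and3P => /and3P [M0 /forallP Hsub /forallP Hmul] _ _.
have sub : forall x y, x \in M -> y \in M -> x - y \in M.
  by move=> x y xM yM; have /implyP /(_ xM) /forall_inP := Hsub x; apply.
have uM := Hu M HM; have vM := Hv M HM.
have auM : a * u \in M by have /forall_inP := Hmul a; apply.
have nvM : - v \in M by rewrite -sub0r; apply: sub.
by rewrite -[v]opprK; apply: sub.
Qed.

Lemma I0_idealr_closed : idealr_closed I0.
Proof.
have [r0 rc] := rad_closed.
split.
- by rewrite /I0 unfold_in /= r0; apply/forall_inP => y _; rewrite mul0r.
- rewrite /I0 unfold_in /=; apply/negP => /andP [r1 /forall_inP /(_ 1 r1)].
  by rewrite mulr1 oner_eq0.
- move=> a u v; rewrite /I0 !unfold_in /= => /andP [ur /forall_inP Hu] /andP [vr /forall_inP Hv].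
  apply/andP; split; first exact: rc.
  apply/forall_inP => y yr.
  by rewrite mulrDl -mulrA (eqP (Hu y yr)) mulr0 (eqP (Hv y yr)) addr0.
Qed.

End FinRingIdeals.



HB.instance Definition _ (R : finComUnitRingType) :=
  isIdealr.Build R (@I0 R) (@I0_idealr_closed R).

Notation quotI0 R := {ideal_quot (@I0 R)}.

Section Generic.
Variable S : comNzRingType.

Definition is_unit_el (a : S) : Prop := exists b, a * b = 1.

Definition ring_aut (s : S -> S) : Prop :=
  [/\ bijective s, forall x y, s (x + y) = s x + s y,
      forall x y, s (x * y) = s x * s y & s 1 = 1].

Definition in_AGammaL1 (f : S -> S) : Prop :=
  exists a b (sg : S -> S), [/\ is_unit_el a, ring_aut sg & forall x, f x = a * sg x + b].

Definition cyc_rel (KS : S -> Prop) (r x y : S) : Prop :=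
  exists k, KS k /\ y - x = r * k.

Definition cyc_aut (KS : S -> Prop) (f : S -> S) : Prop :=
  bijective f /\ forall r x y, cyc_rel KS r x y <-> cyc_rel KS r (f x) (f y).

Definition cyc_ring_aut (KS : S -> Prop) (f : S -> S) : Prop :=
  cyc_aut KS f /\ ring_aut f.
End Generic.

Local Open Scope quotient_scope.

Definition pi0 (R : finComUnitRingType) : R -> quotI0 R := \pi_(quotI0 R).

Section Specific.
Variable R : finComUnitRingType.

Definition Kset (K : {group {unit R}}) : {set R} := [set val u | u in K].

Definition pure (K : {group {unit R}}) : Prop :=
  forall I : {set R}, is_ideal I -> (forall x, x \in I -> 1 + x \in Kset K) ->
    I = [set 0].

Definition KquotI0 (K : {group {unit R}}) : quotI0 R -> Prop :=
  fun q => exists k, k \in Kset K /\ q = pi0 k.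

(* the permutation of R/E_0 = R/I_0 induced by f : R -> R
   (well defined when f preserves E_0, e.g. for f in Aut(C)) *)
Definition induced (f : R -> R) : quotI0 R -> quotI0 R :=
  fun q => pi0 (f (repr q)).
End Specific.

(* Main.v *)
(* For [f] in Aut(C), [f y - f x] lies in [(y - x) K]. The key point is that such an
   [f] which fixes 0 and 1 and is the identity modulo [I0] is the identity. Put
   [d x = f x - x], with values in [I0], and [S = {s in I0 | 1 + s in K}], an additive
   group containing no nonzero ideal by purity. All slopes [(d x - d y) / (x - y)]
   lie in [S], and [d] factors through the residue field. If some such [d] were not of the form
   [s x + c], a non-affine one would have all its differences
   [d (x + b) - d x] affine (translations form a p-group); by symmetry in [x] and
   [b] and by purity it is additive up to a constant. But an additive [d] is a
   combination of Frobenius powers [x ^ (p ^ i)], and the coefficient for each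
   [i > 0] generates an ideal inside [S], hence vanishes.

   Injectivity follows by applying this to [t^-1 o s]. For the last part, normalize
   [f 0 = 0], [f 1 = 1] and compare [f] with [f (u x) / f u] and with
   [(f (x + b) - f b) / (f (1 + b) - f b)], which induce the same map modulo [I0].
   Hence [f] is multiplicative, and additive up to the defects
   [f (1 + y) - f y - 1] in [S]. Expanding [f ((1 + y) ^ p)] shows
   that the defect at [y ^ p] is [p - f p] times a polynomial in [f y] with linear
   term [f y]; as before, [p - f p] generates an ideal inside [S], so it is 0. *)
Require Import Defs.
From HB Require Import structures.
From mathcomp Require Import all_boot all_order all_algebra all_fingroup.
From mathcomp Require Import generic_quotient ring_quotient.
From mathcomp Require Import all_solvable all_field zify ring.

Set Implicit Arguments.
Unset Strict Implicit.
Unset Printing Implicit Defensive.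
Import GRing.Theory.
Local Open Scope ring_scope.

(** * Finite local rings and Teichmueller elements *)

Section LocalRing.
Variable R : finComUnitRingType.
Hypothesis R_local : is_local R.
Implicit Types x y z t : R.

Lemma is_idealP (I : {set R}) :
  reflect [/\ 0 \in I, {in I &, forall x y, x - y \in I}
            & forall a x, x \in I -> a * x \in I] (is_ideal I).
Proof.
apply: (iffP and3P) => -[I0 IB IM]; split=> //.
- by move=> x y xI yI; move/forall_inP/(_ x xI)/forall_inP/(_ y yI): IB.
- by move=> a x xI; move/forallP/(_ a)/forall_inP/(_ x xI): IM.
- by apply/forall_inP=> x xI; apply/forall_inP=> y yI; apply: IB.
- by apply/forallP=> a; apply/forall_inP=> x xI; apply: IM.
Qed.

Lemma principal_ideal x : is_ideal [set a * x | a in [set: R]].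
Proof.
apply/is_idealP; split.
- by apply/imsetP; exists 0; rewrite ?inE ?mul0r.
- move=> _ _ /imsetP[a _ ->] /imsetP[b _ ->].
  by apply/imsetP; exists (a - b); rewrite ?inE ?mulrBl.
- move=> b _ /imsetP[a _ ->].
  by apply/imsetP; exists (b * a); rewrite ?inE ?mulrA.
Qed.

(** A non-unit generates a proper ideal, which finiteness enlarges to a maximal one; by locality
    that one is the radical. *)
Lemma mem_rad x : (x \in Defs.rad R) = (x \isn't a GRing.unit).
Proof.
have [M [Mmax Muniq]] := R_local.
have radE : Defs.rad R = M.
  apply/setP=> y; apply/bigcapP/idP=> [/(_ M Mmax) //| yM M'].
  by move/Muniq=> ->.
have [/is_idealP[_ _ MM] M1 _] := and3P Mmax.
rewrite radE; apply/idP/idP => [xM|xU].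
  by apply: contra M1 => /mulVr <-; apply: MM.
pose P (J : {set R}) := is_ideal J && (1 \notin J).
have PI : P [set a * x | a in [set: R]].
  rewrite /P principal_ideal; apply: contra xU => /imsetP[a _ Dx].
  by apply/unitrPr; exists a; rewrite mulrC.
have [J /maxsetP[/andP[Jid J1] Jmax] sIJ] := maxset_exists PI.
rewrite -(Muniq J); last first.
  apply/and3P; split=> //; apply/forallP => J'; apply/implyP=> /andP[J'id JJ'].
  apply: contraTT JJ' => J'1; rewrite properE negb_and negbK.
  apply/orP; case: (boolP (J \subset J')) => sJ; [right | by left].
  by rewrite (Jmax J') // /P J'id.
by apply: (subsetP sIJ); apply/imsetP; exists 1; rewrite ?inE ?mul1r.
Qed.

Lemma radD x y : x \in Defs.rad R -> y \in Defs.rad R -> x + y \in Defs.rad R.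
Proof. by move=> xm ym; rewrite -[x]mul1r; apply: (rad_closed R).2. Qed.

Lemma rad0 : 0 \in Defs.rad R.
Proof. exact: (rad_closed R).1. Qed.

Lemma radMl a x : x \in Defs.rad R -> a * x \in Defs.rad R.
Proof. by move=> xm; rewrite -[_ * _]addr0; apply: (rad_closed R).2 => //; apply: rad0. Qed.

Lemma radMr a x : x \in Defs.rad R -> x * a \in Defs.rad R.
Proof. by rewrite mulrC; apply: radMl. Qed.

Lemma radN x : x \in Defs.rad R -> - x \in Defs.rad R.
Proof. by rewrite -mulN1r; apply: radMl. Qed.

Lemma radB x y : x \in Defs.rad R -> y \in Defs.rad R -> x - y \in Defs.rad R.
Proof. by move=> xm ym; apply: radD => //; apply: radN. Qed.

Lemma rad_sum (I : finType) (F : I -> R) :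
  (forall i, F i \in Defs.rad R) -> \sum_i F i \in Defs.rad R.
Proof. by move=> Fm; elim/big_ind: _ => //; [exact: rad0 | exact: radD]. Qed.

Lemma unit_rad_addr u x : u \is a GRing.unit -> x \in Defs.rad R -> u + x \is a GRing.unit.
Proof.
move=> uU xm; rewrite -[_ \is a _]negbK -mem_rad; apply: contraL uU => uxm.
by rewrite -mem_rad -[u](addrK x); apply: radB.
Qed.

Lemma mem_radM x y : (x * y \in Defs.rad R) = (x \in Defs.rad R) || (y \in Defs.rad R).
Proof. by rewrite !mem_rad unitrM negb_and. Qed.

(** The least positive integer in the radical is prime because the radical is a prime ideal; [#|R|]
    shows that one exists. *)
Lemma rad_nilpotent_char : exists2 p, prime p & (p%:R : R) \in Defs.rad R.
Proof.
have ex : exists k, (0 < k)%N && ((k%:R : R) \in Defs.rad R).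
  exists #|R|; rewrite -cardsT cardG_gt0 /=.
  have := expg_cardG (in_setT (1 : R)); rewrite FinRing.zmodXgE => /= ->; exact: rad0.
case: (ex_minnP ex) => p /andP[p0 pm] pmin; exists p => //.
apply/primeP; split.
  rewrite ltn_neqAle p0 andbT; apply: contraL pm => /eqP <-.
  by rewrite mem_rad negbK unitr1.
move=> d /dvdnP[e Dp]; move: pm; rewrite Dp natrM mem_radM.
have [d0 e0] : (0 < d)%N /\ (0 < e)%N by split; move: p0; rewrite Dp; case: (d) (e) => [|?] [|?] //; rewrite ?muln0.
case/orP => [em|dm].
  have := pmin e; rewrite e0 em => /(_ isT); rewrite Dp => le.
  by apply/orP; left; rewrite eqn_leq d0 -(leq_pmul2l e0) muln1 le.
have := pmin d; rewrite d0 dm => /(_ isT); rewrite Dp => le.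
by apply/orP; right; rewrite eqn_leq le leq_pmull.
Qed.

End LocalRing.

Section LocalRing.
Variable R : finComUnitRingType.
Hypothesis R_local : is_local R.
Implicit Types x y z t : R.

Lemma pgroup_add p : prime p -> (p%:R : R) \in Defs.rad R -> (p.-group [set: R])%g.
Proof.
move=> p_pr pm; apply/pgroupP=> q q_pr q_dvd.
have [x _ ox] := Cauchy q_pr q_dvd.
apply: contraT => /= neq; have /= := expg_order x; rewrite ox FinRing.zmodXgE => qx.
have qU : (q%:R : R) \is a GRing.unit.
  rewrite -[_ \is a _]negbK -(mem_rad R_local); apply/negP=> qm.
  have cqp : coprime q p by rewrite prime_coprime // dvdn_prime2 // -topredE /= eq_sym in neq *.
  have [u v Duv _] := egcdnP p (prime_gt0 q_pr).
  have : (1 : R) \in Defs.rad R.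
    have -> : 1 = u%:R * q%:R - v%:R * p%:R :> R.
      by rewrite -!natrM Duv (eqP cqp) natrD addrC addKr.
    by apply: radB; apply: radMl.
  by rewrite (mem_rad R_local) unitr1.
move: qx; rewrite -mulr_natr => /(canRL (mulrK qU)); rewrite mul0r => x0.
by move: ox q_pr; rewrite x0 => /= <-; rewrite (order1 R).
Qed.

Lemma unit_abelian : abelian [set: {unit R}]%g.
Proof.
by apply/centsP=> u _ v _; apply: val_inj; rewrite !FinRing.val_unitM mulrC.
Qed.

(** The residue field has [p ^ n] elements, and [g] lifts a generator of its multiplicative group
    without changing its order. *)
Lemma teichmuller_exists :
  exists p n (g : R),
    [/\ prime p /\ (0 < n)%N, (p%:R : R) \in Defs.rad R,
        g ^+ (p ^ n).-1 = 1,
        forall j, ~~ ((p ^ n).-1 %| j)%N -> g ^+ j - 1 \is a GRing.unit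
      & forall x, x ^+ (p ^ n) - x \in Defs.rad R].
Proof.
have [p p_pr pm] := rad_nilpotent_char R_local.
have pR := pgroup_add p_pr pm.
have mG : group_set (Defs.rad R).
  by apply/group_setP; split; [exact: rad0 | move=> x y xm ym; apply: radD].
have [e Dm] := p_natP (pgroupS (subsetT (group mG)) pR).
have [r DR] := p_natP pR; rewrite /= in Dm DR.
have p_gt1 := prime_gt1 p_pr.
have lt_er : (e < r)%N.
  rewrite -(ltn_exp2l _ _ p_gt1) -Dm -DR; apply: proper_card.
  rewrite properT; apply: contraTneq (unitr1 R) => mT.
  by rewrite -(mem_rad R_local) mT inE.
pose n := (r - e)%N; have n0 : (0 < n)%N by rewrite subn_gt0.
have Dr : (p ^ r = p ^ e * p ^ n)%N by rewrite -expnD subnKC // ltnW.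
pose G := [set: {unit R}]%G.
have cG : #|G| = (p ^ e * (p ^ n).-1)%N.
  have -> : #|G| = #|~: Defs.rad R|.
    rewrite -(card_imset _ (val_inj : injective (val : {unit R} -> R))).
    apply: eq_card => x; rewrite inE (mem_rad R_local) negbK.
    apply/imsetP/idP=> [[u _ ->] | xU]; first exact: (valP u).
    by exists (FinRing.unit R xU).
  apply: (@addnI #|Defs.rad R|); rewrite cardsC -cardsT DR Dm Dr.
  by rewrite -mulnS prednK // expn_gt0 ltnW.
(* The principal units [1 + rad R] form the Sylow [p]-subgroup of the unit group. The [p']-core [T]
   below meets it trivially, so [u - 1] is a unit for each nontrivial [u] in [T]; this makes [T]
   cyclic, as for a finite subgroup of a field. *)
pose U1 := [set u : {unit R} | val u - 1 \in Defs.rad R].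
have U1G : group_set U1.
  apply/group_setP; split; first by rewrite inE subrr rad0.
  move=> u v; rewrite !inE FinRing.val_unitM => um vm.
  have -> : val u * val v - 1 = (val u - 1) * val v + (val v - 1) by ring.
  by apply: radD => //; apply: radMr.
pose H := group U1G.
have cH : #|H| = (p ^ e)%N.
  rewrite -Dm -(card_imset _ (_ : injective (fun u : {unit R} => val u - 1))); last first.
    by move=> u v /addIr/val_inj.
  apply: eq_card=> x; apply/imsetP/idP=> [[u] | xm]; first by rewrite inE => um ->.
  have xU := unit_rad_addr R_local (unitr1 R) xm.
  by exists (FinRing.unit R xU); rewrite ?inE /= addrC addKr.
have nN : (p ^ n).-1 != 0%N by rewrite -lt0n -subn1 subn_gt0 -{1}(expn0 p) ltn_exp2l.
have p'N : (p^'.-nat (p ^ n).-1)%N.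
  rewrite p'natE // -subn1 dvdn_subr ?dvdn_exp ?expn_gt0 ?(ltnW p_gt1) // dvdn1.
  by rewrite neq_ltn p_gt1 orbT.
pose T := 'O_p^'(G)%G.
have cT : #|T| = (p ^ n).-1.
  rewrite (card_Hall (nilpotent_pcore_Hall _ (abelian_nil unit_abelian))) cG.
  rewrite partnM ?lt0n // -?lt0n ?expn_gt0 ?prime_gt0 // (part_pnat_id p'N).
  by rewrite part_p'nat ?mul1n // pnatNK pnatX pnat_id.
have TU : {in (T^#)%g, forall u : {unit R}, val u - 1 \is a GRing.unit}.
  move=> u /setD1P[nt_u uT]; apply: contraR nt_u; rewrite -(mem_rad R_local) => um.
  have /coprime_TIg TI : coprime #|H| #|T|.
    by rewrite cH cT; apply: (@pnat_coprime p); rewrite ?pnatX ?pnat_id.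
  by rewrite -in_set1 -[[set 1%g]]TI !inE um.
have abT : abelian T by apply: abelianS unit_abelian; apply: subsetT.
have /cyclicP[t Dt] : cyclic T.
  by apply: (@div_ring_mul_group_cyclic _ T R (fun u => val u)) => // u v _ _; rewrite FinRing.val_unitM.
have ot : #[t]%g = (p ^ n).-1 by rewrite -cT Dt.
exists p, n, (val t); split=> //.
- by rewrite -FinRing.val_unitX -ot expg_order.
- move=> j jN; rewrite -FinRing.val_unitX; apply: TU.
  by rewrite 2!inE -order_dvdn ot jN Dt mem_cycle.
move=> x; case: (boolP (x \in Defs.rad R)) => [xm | xm].
  apply: radB => //; rewrite -(prednK (_ : 0 < p ^ n)%N) ?expn_gt0 ?(ltnW p_gt1) //.
  by rewrite exprS; apply: radMr.
have xU : x \is a GRing.unit by rewrite (mem_rad R_local) negbK in xm.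
pose u := FinRing.unit R xU.
have uN : (u ^+ (p ^ n).-1)%g \in H.
  have nH : [set: {unit R}] \subset 'N(H)%g.
    by apply: sub_abelian_norm unit_abelian (subsetT _).
  have uNH : u \in 'N(H)%g by apply: (subsetP nH).
  apply: coset_idr; first exact: groupX.
  rewrite morphX //; have := @expg_cardG _ (G / H)%G (coset H u).
  rewrite card_quotient // -divgS ?subsetT // cG cH mulKn ?expn_gt0 ?(ltnW p_gt1) //.
  by apply; apply: mem_quotient.
move: uN; rewrite inE FinRing.val_unitX /= => uN.
have -> : x ^+ (p ^ n) - x = x * (x ^+ (p ^ n).-1 - 1).
  by rewrite mulrBr mulr1 -exprS prednK // expn_gt0 ltnW.
exact: radMl.
Qed.

End LocalRing.

(** * Sums of two powers of [p] modulo [p ^ n - 1] *)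

Lemma expn_add_inj p a b c e : (1 < p)%N ->
  (p ^ a + p ^ b = p ^ c + p ^ e)%N -> (a = c /\ b = e) \/ (a = e /\ b = c).
Proof.
move=> p_gt1; have p_gt0 x : (0 < p ^ x)%N by rewrite expn_gt0 ltnW.
(* The left sum is at most [2 * p ^ z], hence at most [p ^ y] even when [p = 2]; so the larger
   exponents must agree. *)
have lt2 x y z t : (x <= z)%N -> (z < y)%N -> (p ^ x + p ^ z < p ^ t + p ^ y)%N.
  move=> xz zy; rewrite -addn1 addnC leq_add //.
  apply: leq_trans (leq_pexp2l (ltnW p_gt1) zy).
  rewrite expnS; apply: leq_trans (_ : 2 * p ^ z <= _)%N; last by rewrite leq_mul2r p_gt1 orbT.
  by rewrite mul2n -addnn leq_add2r leq_pexp2l // ltnW.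
wlog ab : a b / (a <= b)%N => [H | ].
  case/orP: (leq_total a b) => ab; first exact: H.
  by rewrite addnC => /(H _ _ ab)[] []; [right | left].
wlog ce : c e / (c <= e)%N => [H | ].
  case/orP: (leq_total c e) => ce; first exact: H.
  by rewrite [RHS]addnC => /(H _ _ ce)[] []; [right | left].
move=> E; have be : b = e.
  case: (ltngtP b e) => // lt.
    by have := lt2 _ _ _ c ab lt; rewrite E ltnn.
  by have := lt2 _ _ _ a ce lt; rewrite E ltnn.
left; split=> //; apply/eqP; rewrite -(eqn_exp2l _ _ p_gt1).
by move: E; rewrite be => /addIn ->.
Qed.

Lemma expn_mod_pred p n a : (1 < p)%N -> (0 < n)%N ->
  (p ^ a = p ^ (a %% n) %[mod (p ^ n).-1])%N.
Proof.
move=> p_gt1 n0.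
have pn1 : (p ^ n = 1 %[mod (p ^ n).-1])%N.
  by rewrite -{1}[(p ^ n)%N]prednK ?expn_gt0 ?(ltnW p_gt1) // -addn1 modnDl.
have pnk k : ((p ^ n) ^ k = 1 %[mod (p ^ n).-1])%N.
  by rewrite -modnXm pn1 modnXm exp1n.
by rewrite {1}(divn_eq a n) expnD [(_ %/ _ * _)%N]mulnC expnM -modnMml pnk modnMml mul1n.
Qed.

(** Both sums lie between 2 and [p ^ n], so congruence modulo [p ^ n - 1] forces equality. *)
Lemma expn_add_mod p n a b c e : (1 < p)%N -> (a < n)%N -> (b < n)%N -> (c < n)%N -> (e < n)%N ->
  (p ^ a + p ^ b = p ^ c + p ^ e %[mod (p ^ n).-1])%N ->
  (a = c /\ b = e) \/ (a = e /\ b = c).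
Proof.
move=> p_gt1 an bn cn en E; apply: (@expn_add_inj p) => //.
have n0 : (0 < n)%N by apply: leq_ltn_trans an.
have half x : (x < n)%N -> (0 < p ^ x /\ 2 * p ^ x <= p ^ n)%N.
  move=> xn; rewrite expn_gt0 (ltnW p_gt1); split=> //.
  apply: leq_trans (leq_pexp2l (ltnW p_gt1) xn); rewrite expnS leq_mul2r p_gt1.
  by rewrite orbT.
move: (half a an) (half b bn) (half c cn) (half e en) E.
move: (p ^ a)%N (p ^ b)%N (p ^ c)%N (p ^ e)%N (p ^ n)%N => A B C E q.
wlog le : A B C E / (A + B <= C + E)%N => [H | ] hA hB hC hE ABCE.
  case/orP: (leq_total (A + B) (C + E)) => le; first exact: H.
  by apply: esym; apply: H.
move/eqP: ABCE; rewrite eq_sym eqn_mod_dvd // => /dvdnP[[|k]]; first lia.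
by rewrite mulSn; move: (k * q.-1)%N => kq; lia.
Qed.

(** * The annihilator [I0] of the radical *)

Section LocalRing.
Variable R : finComUnitRingType.
Hypothesis R_local : is_local R.
Implicit Types x y z t s : R.
Local Notation m := (Defs.rad R).

Lemma mem_set_eq (A : {set R}) x y : x = y -> x \in A -> y \in A.
Proof. by move=> ->. Qed.

Lemma mem_I0 s : s \in @I0 R -> s \in m /\ forall x, x \in m -> x * s = 0.
Proof.
case/andP=> sm /forall_inP sI; split=> // x /sI/eqP; by rewrite mulrC.
Qed.

Lemma I0D s t : s \in @I0 R -> t \in @I0 R -> s + t \in @I0 R.
Proof. by move=> sI tI; rewrite -[s]mul1r; have [_ _] := I0_idealr_closed R; apply. Qed.

Lemma I0_0 : 0 \in @I0 R.
Proof. by have [] := I0_idealr_closed R. Qed.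

Lemma I0Ml x s : s \in @I0 R -> x * s \in @I0 R.
Proof.
move=> sI; rewrite -[_ * _]addr0; have [_ _] := I0_idealr_closed R; apply=> //.
exact: I0_0.
Qed.

Lemma I0N s : s \in @I0 R -> - s \in @I0 R.
Proof. by rewrite -mulN1r; apply: I0Ml. Qed.

Lemma I0B s t : s \in @I0 R -> t \in @I0 R -> s - t \in @I0 R.
Proof. by move=> sI tI; apply: I0D => //; apply: I0N. Qed.

Lemma I0_rad s : s \in @I0 R -> s \in m.
Proof. by case/mem_I0. Qed.

Lemma I0_mul0 x s : x \in m -> s \in @I0 R -> x * s = 0.
Proof. by move=> xm /mem_I0[_]; apply. Qed.

(** [I0] is a vector space over the residue field: scalars act through their residues. *)
Lemma I0_mul_congr x y s : x - y \in m -> s \in @I0 R -> x * s = y * s.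
Proof. by move=> xy sI; apply/eqP; rewrite -subr_eq0 -mulrBl I0_mul0. Qed.

(** * Frobenius, the prime field, the trace and character sums *)

Section ResidueChar.
Variable p : nat.
Hypotheses (p_pr : prime p) (p_rad : (p%:R : R) \in m).

Lemma natr_rad k : (p %| k)%N -> (k%:R : R) \in m.
Proof. by case/dvdnP=> q ->; rewrite natrM; apply: radMl. Qed.


(* [frob_defect x y] is [((x + y) ^+ p - x ^+ p - y ^+ p) / p], the quotient being
   taken in the integers. *)
Definition frob_defect x y :=
  \sum_(i < p.-1) ('C(p, i.+1) %/ p)%:R * x ^+ (p - i.+1) * y ^+ i.+1.

Lemma exprD_frob_defect x y : (x + y) ^+ p = x ^+ p + y ^+ p + p%:R * frob_defect x y.
Proof.
rewrite /frob_defect; have := p_pr; case: p => // q q_pr.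
rewrite exprDn big_ord_recl big_ord_recr /= /bump /= !add1n.
rewrite bin0 binn subnn subn0 !mulr1n !expr0 mulr1 mul1r -addrA [_ + y ^+ _]addrC.
congr (_ + (_ + _)); rewrite mulr_sumr; apply: eq_bigr => i _.
have iq : (0 < i.+1 < q.+1)%N by exact: (ltn_ord i).
rewrite !mulrA -natrM mulnC (divnK (prime_dvd_bin q_pr iq)).
by rewrite /bump add1n -mulr_natl mulrA.
Qed.

Lemma exprD_rad x y : (x + y) ^+ p - (x ^+ p + y ^+ p) \in m.
Proof. by rewrite exprD_frob_defect addrC addKr; apply: radMr. Qed.

Lemma expr_sum_rad k (F : 'I_k -> R) :
  (\sum_i F i) ^+ p - \sum_i F i ^+ p \in m.
Proof.
elim: k F => [|k IH] F.
  by rewrite !big_ord0 expr0n gtn_eqF ?prime_gt0 // subrr; apply: rad0.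
rewrite !big_ord_recl.
have := radD (exprD_rad (F ord0) (\sum_(i < k) F (lift ord0 i))) (IH (F \o lift ord0)).
by apply: mem_set_eq; rewrite /=; ring.
Qed.

(** This lifts the factorization of [X^p - X] over the prime field: the integer polynomial [A]
    vanishes modulo [p], so its coefficients fall into the radical. *)
Lemma prod_subr_nat_rad t : \prod_(k < p) (t - k%:R) - (t ^+ p - t) \in m.
Proof.
pose A : {poly int} := \prod_(k < p) ('X - k%:R%:P) - ('X^p - 'X).
have hA : \prod_(k < p) (t - k%:R) - (t ^+ p - t) = (map_poly intr A).[t].
  rewrite /A !(rmorphB, rmorph_prod) /= map_polyXn map_polyX !hornerE horner_prod.
  congr (_ - _); apply: eq_bigr => k _.
  by rewrite rmorphB /= map_polyX map_polyC /= !hornerE rmorph_nat.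
have A0 : map_poly (intr : int -> 'F_p) A = 0.
  rewrite /A !(rmorphB, rmorph_prod) /= map_polyXn map_polyX.
  have := finField_genPoly 'F_p; rewrite card_Fp // => ->.
  have -> : \prod_(x : 'F_p) ('X - x%:P) = \prod_(0 <= k < p) ('X - (k%:R : 'F_p)%:P).
    rewrite -[X in index_iota _ X](Fp_cast p_pr) big_mkord.
    by apply: eq_bigr => k _; rewrite natr_Zp.
  rewrite big_mkord; apply/eqP; rewrite subr_eq0; apply/eqP/eq_bigr => k _.
  by rewrite rmorphB /= map_polyX map_polyC /= rmorph_nat.
rewrite hA horner_coef; apply: rad_sum => i; apply: radMr.
rewrite coef_map /=; have /(congr1 (fun q : {poly 'F_p} => q`_i)) := A0.
rewrite coef_map coef0 /=; case: (A`_i) => k /eqP.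
  by rewrite -pmulrn -(dvdn_pcharf (pchar_Fp p_pr)) => /natr_rad.
rewrite NegzE mulrNz oppr_eq0 -pmulrn -(dvdn_pcharf (pchar_Fp p_pr)) => /natr_rad.
by rewrite rmorphN /= -pmulrn; apply: radN.
Qed.

(** Some factor [t - k] lies in the radical, a prime ideal: a residue fixed by Frobenius is in the
    prime field. *)
Lemma frob_fixed_nat t : t ^+ p - t \in m -> exists k, t - k%:R \in m.
Proof.
move=> tm; have := radD (prod_subr_nat_rad t) tm; rewrite subrK.
elim/big_rec: _ => [|k z _ IH]; first by rewrite (mem_rad R_local) unitr1.
by rewrite mem_radM // => /orP[|/IH//]; exists k.
Qed.

Section Trace.
Variable n : nat.
Hypotheses (n_gt0 : (0 < n)%N) (frobn : forall x, x ^+ (p ^ n) - x \in m).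

(** Represents the trace from the residue field to its prime field, without forming the quotient. *)
Definition frob_trace x := \sum_(i < n) x ^+ (p ^ i).

(** Modulo the radical, Frobenius permutes the summands cyclically. *)
Lemma frob_trace_nat x : exists k, frob_trace x - k%:R \in m.
Proof.
apply: frob_fixed_nat; rewrite /frob_trace.
have := radD (expr_sum_rad (fun i : 'I_n => x ^+ (p ^ i))) (frobn x).
apply: mem_set_eq.
have -> : \sum_(i < n) (x ^+ (p ^ i)) ^+ p = \sum_(i < n) x ^+ (p ^ i) - x + x ^+ (p ^ n).
  have -> : \sum_(i < n) (x ^+ (p ^ i)) ^+ p = \sum_(i < n) x ^+ (p ^ i.+1).
    by apply: eq_bigr => i _; rewrite -exprM -expnSr.
  rewrite -(big_mkord predT (fun i => x ^+ (p ^ i))) -(big_mkord predT (fun i => x ^+ (p ^ i.+1))).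
  case: (n) n_gt0 => // k _; rewrite big_nat_recr //= big_nat_recl //= expn0 expr1.
  by ring.
by ring.
Qed.

Variable g : R.
Hypotheses (gN : g ^+ (p ^ n).-1 = 1)
  (gU : forall j, ~~ ((p ^ n).-1 %| j)%N -> g ^+ j - 1 \is a GRing.unit).
Local Notation N := (p ^ n).-1.
(* The inverse of [g], kept as a natural power so that all exponents are in [nat]. *)
Local Notation h := (g ^+ N.-1).

(** Orthogonality of characters: the geometric sum is annihilated by [g ^+ e - 1], a unit unless [N]
    divides [e]. *)
Lemma sum_teichmuller_expr e : \sum_(l < N) g ^+ (l * e) = if (N %| e)%N then N%:R else 0.
Proof.
have -> : \sum_(l < N) g ^+ (l * e) = \sum_(l < N) (g ^+ e) ^+ l.
  by apply: eq_bigr => l _; rewrite mulnC exprM.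
case: ifPn => [/dvdnP[k ->] | /gU eU].
  rewrite mulnC exprM gN expr1n.
  by under eq_bigr do rewrite expr1n; rewrite sumr_const card_ord.
by apply: (mulrI eU); rewrite mulr0 -subrX1 -exprM mulnC exprM gN expr1n subrr.
Qed.

Lemma pred_expn_prime_gt0 : (0 < N)%N.
Proof.
by rewrite -subn1 subn_gt0 -{1}(expn0 p) ltn_exp2l ?prime_gt1.
Qed.

(** Modulo [N], the factor [N.-1] stands for -1. *)
Lemma dvdn_addr_mul_pred a b : (N %| a + N.-1 * b)%N = (a == b %[mod N]).
Proof.
rewrite -[in RHS](eqn_modDr (N.-1 * b)) -[X in _ == (X + _)%N %[mod _]]mul1n -mulnDl add1n.
by rewrite prednK ?pred_expn_prime_gt0 // modnMr.
Qed.

Lemma teichmuller_mulV l : g ^+ l * h ^+ l = 1.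
Proof. by rewrite -exprMn -exprS prednK ?pred_expn_prime_gt0 // gN expr1n. Qed.

(** [p ^ n] annihilates [I0]; thus inverting a character sum on [I0] costs only a sign. *)
Lemma teichmuller_card_I0 s : s \in @I0 R -> N%:R * s = - s.
Proof.
move=> sI; have : (p ^ n)%:R * s = 0.
  by apply: I0_mul0 => //; apply: natr_rad; rewrite dvdn_exp.
rewrite -{1}[(p ^ n)%N]prednK ?expn_gt0 ?prime_gt0 // -natr1 mulrDl mul1r.
by move/eqP; rewrite addr_eq0 => /eqP.
Qed.

End Trace.
End ResidueChar.
End LocalRing.

(** * Functions with slopes in [S] *)

Section Slopes.
Variables (R : finComUnitRingType) (K : {group {unit R}}).
Hypotheses (R_local : is_local R) (K_pure : pure K).
Implicit Types x y z t s : R.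
Local Notation m := (Defs.rad R).

Lemma Kset1 : 1 \in Kset K.
Proof. by apply/imsetP; exists 1%g; rewrite ?group1. Qed.

Lemma KsetM x y : x \in Kset K -> y \in Kset K -> x * y \in Kset K.
Proof.
move=> /imsetP[u uK ->] /imsetP[v vK ->]; apply/imsetP.
by exists (u * v)%g; rewrite ?groupM.
Qed.

Lemma KsetV x : x \in Kset K -> x^-1 \in Kset K.
Proof.
move=> /imsetP[u uK ->]; apply/imsetP.
by exists (u^-1)%g; rewrite ?groupV // FinRing.val_unitV.
Qed.

Lemma Kset_unit x : x \in Kset K -> x \is a GRing.unit.
Proof. by move=> /imsetP[u _ ->]; apply: (valP u). Qed.

Definition Sset : {set R} := [set s | (s \in @I0 R) && (1 + s \in Kset K)].

Lemma Sset_I0 s : s \in Sset -> s \in @I0 R.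
Proof. by rewrite inE => /andP[]. Qed.

Lemma Sset0 : 0 \in Sset.
Proof. by rewrite inE I0_0 addr0 Kset1. Qed.

(** Products of two elements of [I0] vanish, so [1 + s] turns sums into products in [K]. *)
Lemma SsetD s t : s \in Sset -> t \in Sset -> s + t \in Sset.
Proof.
rewrite !inE => /andP[sI sK] /andP[tI tK]; rewrite I0D //=.
have -> : 1 + (s + t) = (1 + s) * (1 + t).
  by rewrite mulrDl mul1r mulrDr mulr1 (I0_mul0 (I0_rad sI) tI) addr0 addrA addrAC.
exact: KsetM.
Qed.

Lemma SsetN s : s \in Sset -> - s \in Sset.
Proof.
rewrite !inE => /andP[sI sK]; rewrite I0N //=.
suff -> : 1 - s = (1 + s)^-1 by apply: KsetV.
apply: (mulrI (Kset_unit sK)); rewrite mulrV ?(Kset_unit sK) //.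
by rewrite mulrC -subr_sqr expr1n expr2 (I0_mul0 (I0_rad sI) sI) subr0.
Qed.

Lemma SsetB s t : s \in Sset -> t \in Sset -> s - t \in Sset.
Proof. by move=> sS tS; apply: SsetD => //; apply: SsetN. Qed.

Lemma Sset_sum (I : finType) (F : I -> R) :
  (forall i, F i \in Sset) -> \sum_i F i \in Sset.
Proof. by move=> FS; elim/big_ind: _ => //; [exact: Sset0 | exact: SsetD]. Qed.

(** An additive group absorbs integer scalars, and on [I0] these are the scalars from the prime
    field. This is why traces appear as coefficients later. *)
Lemma Sset_natl k t s : t - k%:R \in m -> s \in Sset -> t * s \in Sset.
Proof.
move=> tk sS; rewrite (I0_mul_congr tk (Sset_I0 sS)) mulr_natl.
by elim: k {tk} => [|k IH]; rewrite ?mulr0n ?Sset0 // mulrS SsetD.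
Qed.

(** The principal ideal of [v] would lie in [Sset K]. This is the form in which purity is
    applied. *)
Lemma pure_Sset v : (forall c, c * v \in Sset) -> v = 0.
Proof.
move=> vS; suff: v \in [set a * v | a in [set: R]].
  by rewrite (K_pure (principal_ideal v)) ?inE => [/eqP|_ /imsetP[a _ ->]] //;
     have := vS a; rewrite inE => /andP[].
by apply/imsetP; exists 1; rewrite ?inE ?mul1r.
Qed.

Section Teichmuller.
Variables (p n : nat) (g : R).
Hypotheses (p_pr : prime p) (p_rad : (p%:R : R) \in m).
Hypotheses (n_gt0 : (0 < n)%N) (frobn : forall x, x ^+ (p ^ n) - x \in m).
Local Notation N := (p ^ n).-1.
Local Notation h := (g ^+ N.-1).
Hypotheses (gN : g ^+ N = 1)
  (gU : forall j, ~~ (N %| j)%N -> g ^+ j - 1 \is a GRing.unit).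

Lemma Sset_frob_trace t s : s \in Sset -> frob_trace p n t * s \in Sset.
Proof. by have [k /Sset_natl] := frob_trace_nat R_local p_pr p_rad n_gt0 frobn t; apply. Qed.

(** * Additive functions as Frobenius polynomials *)

Section Additive.
Variable d : R -> R.
Hypotheses (dI : forall x, d x \in @I0 R) (dD : forall x y, d (x + y) = d x + d y)
  (d_rad : forall x, x \in m -> d x = 0).

Lemma additive0 : d 0 = 0.
Proof. by rewrite d_rad ?rad0. Qed.

Lemma additive_sum (I : finType) (F : I -> R) : d (\sum_i F i) = \sum_i d (F i).
Proof. exact: (big_morph d dD additive0). Qed.

Lemma additive_natl k t x : t - k%:R \in m -> d (t * x) = t * d x.
Proof.
move=> tk; rewrite (I0_mul_congr tk (dI x)).
have -> : t * x = (t - k%:R) * x + k%:R * x by rewrite -mulrDl subrK.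
rewrite dD d_rad ?radMr // add0r !mulr_natl.
by elim: k {tk} => [|k IH]; rewrite ?mulr0n ?additive0 // !mulrS dD IH.
Qed.

(* Writing [x] as [- \sum_u frob_trace (x / u) * u] over the powers [u] of [g] and
   applying [d], which is linear over the prime field, gives these coefficients. *)
Let frob_coef i := - \sum_(l < N) h ^+ (l * p ^ i) * d (g ^+ l).

Lemma frob_coef_I0 i : frob_coef i \in @I0 R.
Proof.
apply/I0N; elim/big_ind: _ => [|x y|l _]; [exact: I0_0 | exact: I0D | exact: I0Ml].
Qed.

Lemma dvdn_frob_exponent i : (i < n)%N -> (N %| 1 + N.-1 * p ^ i)%N = (i == 0%N).
Proof.
move=> lt_in; rewrite (dvdn_addr_mul_pred p_pr n_gt0); apply/eqP/eqP=> [E | ->]; last by rewrite expn0.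
(* Adding [p ^ 0] to both sides reduces the congruence to one between sums of two powers. *)
have : (p ^ 0 + p ^ 0 = p ^ i + p ^ 0 %[mod N])%N.
  by rewrite -modnDml expn0 E modnDml.
by case/(expn_add_mod (prime_gt1 p_pr) n_gt0 n_gt0 lt_in n_gt0) => -[].
Qed.

Lemma additive_frob_poly x : d x = \sum_(i < n) x ^+ (p ^ i) * frob_coef i.
Proof.
(* Orthogonality leaves only the summand [i = 0] of the trace. *)
have sumE : \sum_(l < N) frob_trace p n (x * h ^+ l) * g ^+ l = N%:R * x.
  under eq_bigr do rewrite mulr_suml.
  rewrite exchange_big /= (bigD1 (Ordinal n_gt0)) //= [X in _ + X]big1 => [|i i0].
    rewrite addr0; under eq_bigr => l _ do
      rewrite expn0 expr1 -mulrA [h ^+ l * _]mulrC (teichmuller_mulV p_pr n_gt0 gN) mulr1.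
    by rewrite sumr_const card_ord mulr_natl.
  rewrite (eq_bigr (fun l : 'I_N => x ^+ (p ^ i) * g ^+ (l * (1 + N.-1 * p ^ i)))).
    by rewrite -mulr_sumr (sum_teichmuller_expr gN gU) dvdn_frob_exponent // [_ == _](negPf i0) mulr0.
  move=> l _; rewrite exprMn -!exprM -mulrA -exprD; congr (_ * g ^+ _); ring.
apply: oppr_inj; rewrite -(teichmuller_card_I0 p_pr p_rad n_gt0 (dI x)) -(@additive_natl N) ?subrr ?rad0 //.
rewrite -sumE additive_sum.
have dtr l : d (frob_trace p n (x * h ^+ l) * g ^+ l) = frob_trace p n (x * h ^+ l) * d (g ^+ l).
  have [k tk] := frob_trace_nat R_local p_pr p_rad n_gt0 frobn (x * h ^+ l).
  exact: additive_natl tk.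
under eq_bigr => l _ do rewrite dtr mulr_suml.
rewrite exchange_big -sumrN; apply: eq_bigr => i _.
rewrite mulrN opprK mulr_sumr; apply: eq_bigr => l _.
by rewrite mulrA exprMn -[(h ^+ l) ^+ _]exprM.
Qed.

Hypothesis d_slope : forall l, h ^+ l * d (g ^+ l) \in Sset.

(** The condition reads [p ^ s + p ^ j = p ^ (s + i) + 1] modulo [N]. Matching exponents modulo [n],
    [s = s + i] is excluded by [0 < i < n], which leaves [s = 0] and [j = i]. *)
Lemma dvdn_frob_exponents (i s j : nat) : (0 < i < n)%N -> (s < n)%N -> (j < n)%N ->
  (N %| p ^ s + p ^ j + N.-1 * (p ^ (s + i) + 1))%N = (s == 0%N) && (j == i).
Proof.
move=> /andP[i0 lt_in] sn jn; rewrite (dvdn_addr_mul_pred p_pr n_gt0).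
apply/eqP/andP=> [E | [/eqP-> /eqP->]]; last by rewrite expn0 addnC add0n.
have sin : ((s + i) %% n < n)%N by rewrite ltn_pmod.
have : (p ^ s + p ^ j = p ^ ((s + i) %% n) + p ^ 0 %[mod N])%N.
  by rewrite E -modnDml expn_mod_pred ?prime_gt1 // modnDml.
case/(expn_add_mod (prime_gt1 p_pr) sn jn sin n_gt0) => -[Ds Dj]; last first.
  by move: Dj; rewrite Ds add0n modn_small // => ->.
move/eqP: Ds; rewrite -{1}(modn_small sn) -{1}[s]addn0 eqn_modDl mod0n modn_small //.
by rewrite eq_sym -leqn0 leqNgt i0.
Qed.

(* Fourier inversion over the powers of [g] isolates [c * frob_coef i] as a
   combination of slopes with coefficients in the prime field, because the
   characters [u ^ (p ^ i - 1)] are pairwise non-conjugate under Frobenius. *)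
Lemma frob_coef_eq0 i : (0 < i < n)%N -> frob_coef i = 0.
Proof.
move=> i_n; have lt_in : (i < n)%N by case/andP: i_n.
apply: pure_Sset => c; rewrite -[_ * _]opprK; apply: SsetN.
pose e (s j : nat) := (p ^ s + p ^ j + N.-1 * (p ^ (s + i) + 1))%N.
have sumE : \sum_(l < N) frob_trace p n (c * (g ^+ l * h ^+ (l * p ^ i))) * (h ^+ l * d (g ^+ l))
    = \sum_(s < n) \sum_(j < n) c ^+ (p ^ s) * ((\sum_(l < N) g ^+ (l * e s j)) * frob_coef j).
  under eq_bigr => l _ do rewrite additive_frob_poly mulr_suml.
  rewrite exchange_big; apply: eq_bigr => s _ /=.
  under eq_bigr => l _ do rewrite !mulr_sumr.
  rewrite exchange_big; apply: eq_bigr => j _ /=.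
  rewrite mulr_suml mulr_sumr; apply: eq_bigr => l _.
  rewrite exprMn -mulrA; congr (_ * _); rewrite !mulrA; congr (_ * _).
  rewrite exprMn -!exprM -!exprD /e; congr (_ ^+ _).
  rewrite expnD; ring.
suff <- : \sum_(l < N) frob_trace p n (c * (g ^+ l * h ^+ (l * p ^ i))) * (h ^+ l * d (g ^+ l))
    = - (c * frob_coef i).
  by apply: Sset_sum => l; apply: Sset_frob_trace.
have ordE (s j : nat) : (s < n)%N -> (j < n)%N ->
    \sum_(l < N) g ^+ (l * e s j) = if (s == 0%N) && (j == i) then N%:R else 0.
  by move=> sn jn; rewrite (sum_teichmuller_expr gN gU) dvdn_frob_exponents.
rewrite sumE (bigD1 (Ordinal n_gt0)) //= [X in _ + X]big1 => [|s s0]; last first.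
  have {}s0 : (s == 0 :> nat)%N = false by apply: negbTE.
  by apply: big1 => j _; rewrite ordE // s0 mul0r mulr0.
rewrite addr0 (bigD1 (Ordinal lt_in)) //= [X in _ + X]big1 => [|j j_i].
  rewrite addr0 ordE // !eqxx expn0 expr1 -(teichmuller_card_I0 p_pr p_rad n_gt0 (I0Ml c (frob_coef_I0 i))).
  by rewrite mulrCA.
have {}j_i : (j == i :> nat)%N = false by apply: negbTE.
by rewrite ordE // j_i andbF mul0r mulr0.
Qed.

Lemma additive_slopes_linear x : d x = x * d 1.
Proof.
have dE y : d y = y * frob_coef 0.
  rewrite additive_frob_poly (bigD1 (Ordinal n_gt0)) //= expn0 expr1 big1 ?addr0 // => i i0.
  by rewrite frob_coef_eq0 ?mulr0 // lt0n i0 ltn_ord.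
by rewrite !dE mul1r.
Qed.

End Additive.
End Teichmuller.
End Slopes.

(** * Functions with slopes are affine; rigidity modulo [I0] *)

Section Slopes.
Variables (R : finComUnitRingType) (K : {group {unit R}}).
Hypotheses (R_local : is_local R) (K_pure : pure K).
Implicit Types (x y z t s b c : R) (d f : R -> R).
Local Notation m := (Defs.rad R).

Definition has_slopes d : Prop :=
  [/\ forall x, d x \in @I0 R, forall x y, x - y \in m -> d x = d y
    & forall x y, x - y \is a GRing.unit -> (x - y)^-1 * (d x - d y) \in Sset K].

(** Boolean, so that a least number of differencing steps can be chosen. *)
Definition affine d : bool :=
  [exists s in Sset K, exists c, [forall x, d x == s * x + c]].

Definition diff b d x := d (x + b) - d x.

Lemma affineP d :
  reflect (exists s c, s \in Sset K /\ forall x, d x = s * x + c) (affine d).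
Proof.
apply: (iffP exists_inP) => [[s sS /existsP[c /forallP dE]] | [s [c [sS dE]]]].
  by exists s, c; split=> // x; apply/eqP.
by exists s => //; apply/existsP; exists c; apply/forallP => x; apply/eqP.
Qed.

Lemma eq_affine d e : d =1 e -> affine d -> affine e.
Proof. by move=> de /affineP[s [c [sS dE]]]; apply/affineP; exists s, c; split=> // x; rewrite -de. Qed.

Lemma affine_const d c : (forall x, d x = c) -> affine d.
Proof. by move=> dE; apply/affineP; exists 0, c; split=> [|x]; rewrite ?Sset0 // mul0r add0r. Qed.

Lemma affine_diff b d : affine d -> affine (diff b d).
Proof.
case/affineP=> s [c [sS dE]]; apply: (@affine_const _ (s * b)) => x.
by rewrite /diff !dE; ring.
Qed.

Lemma affine_diffC b c d : affine (diff b d) -> affine (diff b (diff c d)).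
Proof.
move/(affine_diff c); apply: eq_affine => x; rewrite /diff.
by rewrite (addrAC x b c); ring.
Qed.

Lemma has_slopes_diff b d : has_slopes d -> has_slopes (diff b d).
Proof.
have subb x y : x + b - (y + b) = x - y by ring.
case=> dI d_rad d_slope; split=> [x | x y xy | x y xy].
- by apply: I0B.
- by rewrite /diff (d_rad _ _ xy) (d_rad (x + b) (y + b)) ?subb.
have -> : (x - y)^-1 * (diff b d x - diff b d y) =
    (x + b - (y + b))^-1 * (d (x + b) - d (y + b)) - (x - y)^-1 * (d x - d y).
  by rewrite subb /diff; ring.
by apply: SsetB; apply: d_slope; rewrite ?subb.
Qed.

(** Any bound [M] above [k] is allowed, the extra binomials being 0; this slack lets the induction
    step align both sums. *)
Lemma iter_diffE b d k M x : (k < M)%N ->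
  iter k (diff b) d x = \sum_(i < M) (-1) ^+ (k + i) * 'C(k, i)%:R * d (x + b *+ i).
Proof.
elim: k M x => [|k IH] M x kM.
  case: M kM => // M _; rewrite big_ord_recl /= big1 => [|i _]; last first.
    by rewrite bin0n /= mulr0 mul0r.
  by rewrite bin0 mulr0n !addr0 expr0 !mul1r.
case: M kM => // M kM; rewrite iterS {1}/diff (IH M _ kM) (IH M.+1 _ (ltnW kM)).
rewrite big_ord_recl [in RHS]big_ord_recl /= !bin0 mulr0n addr0 !addn0 opprD.
rewrite addrCA -sumrN -big_split /=; congr (_ + _); first by rewrite exprS; ring.
apply: eq_bigr => i _; rewrite /bump add1n binS natrD mulrSr addrA.
rewrite addSn addnS !exprS [x + b + _]addrAC; ring.
Qed.

(** Inner binomials are multiples of [p] and annihilate [I0]. The end terms share the value [d x],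
    since [b *+ p] is in the radical, with total coefficient [(-1) ^+ p + 1], also in the
    radical. *)
Lemma iter_diff_prime b d p x : prime p -> (p%:R : R) \in m -> has_slopes d ->
  iter p (diff b) d x = 0.
Proof.
move=> p_pr p_rad [dI d_rad _]; rewrite (iter_diffE _ _ _ (ltnSn p)).
rewrite big_ord_recr /=.
have bpm : x + b *+ p - x \in m by rewrite addrC addKr -mulr_natl; apply: radMr.
rewrite (d_rad _ _ bpm) binn mulr1.
case: p p_pr p_rad bpm => // q p_pr p_rad _; rewrite big_ord_recl /= bin0 mulr1 addn0 mulr0n addr0.
rewrite big1 => [|i _].
  rewrite addr0 -mulrDl exprD -expr2 sqrr_sign.
  apply: I0_mul0 => //; have := exprD_rad p_pr p_rad 1 (-1).
  by rewrite subrr expr0n /= expr1n sub0r => /radN; rewrite opprK addrC.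
apply: I0_mul0 => //; apply: radMl; apply: (natr_rad p_rad).
by apply: prime_dvd_bin => //=; exact: (ltn_ord i).
Qed.

(* Repeated differencing lands on the affine functions because [iter p (diff b)]
   vanishes; the last non-affine iterate is kept, for one increment [b] after the
   other. *)
Lemma nonaffine_affine_diff d (bs : seq R) : has_slopes d -> ~~ affine d ->
  exists e, [/\ has_slopes e, ~~ affine e & {in bs, forall b, affine (diff b e)}].
Proof.
move=> dS dA; have [p p_pr p_rad] := rad_nilpotent_char R_local.
elim: bs => [|b bs [e [eS eA eP]]]; first by exists d.
have ex : exists k, affine (iter k (diff b) e).
  by exists p; apply: (@affine_const _ 0) => x; apply: iter_diff_prime.
have [[|k] kA kmin] := ex_minnP ex; first by rewrite /= (negPf eA) in kA.
exists (iter k (diff b) e); split.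
- by elim: k {kA kmin} => //= k IH; apply: has_slopes_diff.
- by apply/negP => /kmin; rewrite ltnn.
move=> b'; rewrite inE => /orP[/eqP-> // | b'bs].
by elim: k {kA kmin} => [|k IH]; [exact: eP | exact: affine_diffC].
Qed.

Lemma has_slopes_affine d : has_slopes d -> affine d.
Proof.
move=> dS; apply: contraT => dA.
have [e [[eI e_rad e_slope] eA eP]] := nonaffine_affine_diff (enum R) dS dA.
(* The mixed second difference is linear in [x] and symmetric in [x] and [b]. *)
have diffP b : exists2 s, s \in Sset K & forall x, e (x + b) - e x - e b + e 0 = s * x.
  have /affineP[s [c [sS eE]]] := eP b (mem_enum _ b).
  exists s => // x; have := eE 0; have := eE x; rewrite /diff mulr0 !add0r => -> <-.
  by ring.
have [s1 s1S s1P] := diffP 1.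
(* By symmetry the coefficient for [b] is [s1 * b]; hence all multiples of [s1] lie in [Sset K]. *)
have s1b b : exists2 s, s \in Sset K & s = s1 * b.
  have [s sS sP] := diffP b; exists s => //.
  by rewrite -s1P -[LHS]mulr1 -sP [1 + b]addrC; ring.
have s1_0 : s1 = 0 by apply: (pure_Sset K_pure) => c; rewrite mulrC; have [s sS <-] := s1b c.
have eD x y : e (x + y) - e 0 = (e x - e 0) + (e y - e 0).
  have [s sS sP] := diffP y; have s0 : s = 0.
    have : s * 1 = s1 * y by rewrite -sP -s1P [1 + y]addrC; ring.
    by rewrite s1_0 mul0r mulr1.
  have := sP x; rewrite s0 mul0r => /eqP; rewrite addr_eq0 => /eqP E.
  have -> : e (x + y) = (e (x + y) - e x - e y) + e x + e y by ring.
  by rewrite E; ring.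
have [p [n [g [[p_pr n_gt0] p_rad gN gU frobn]]]] := teichmuller_exists R_local.
have e_g l : (g ^+ (p ^ n).-2) ^+ l * (e (g ^+ l) - e 0) \in Sset K.
  have gh := teichmuller_mulV p_pr n_gt0 gN l.
  have glU : g ^+ l \is a GRing.unit by apply/unitrPr; eexists; exact: gh.
  have := e_slope (g ^+ l) 0; rewrite subr0 => /(_ glU).
  by rewrite -[X in X * _ \in _ -> _]mulr1 -gh mulKr.
(* Now [e - e 0] is additive, hence linear, contradicting that [e] is not affine. *)
have eL := additive_slopes_linear R_local K_pure p_pr p_rad n_gt0 frobn gN gU
  (fun x => I0B (eI x) (eI 0)) eD _ e_g.
case/negP: eA; apply/affineP; exists (e 1 - e 0), (e 0); split.
  by have := e_slope 1 0; rewrite subr0 invr1 mul1r; apply; rewrite unitr1.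
move=> x; rewrite mulrC -eL ?subrK // => y ym.
by rewrite (e_rad y 0) ?subrr ?subr0.
Qed.

Definition K_slopes f : Prop :=
  forall x y, exists2 k, k \in Kset K & f y - f x = (y - x) * k.

Lemma K_slopes_id_mod_I0 f : K_slopes f -> f 0 = 0 -> f 1 = 1 ->
  (forall x, f x - x \in @I0 R) -> f =1 id.
Proof.
move=> fK f0 f1 fI; pose d x := f x - x.
have d_slope x y : x - y \is a GRing.unit -> (x - y)^-1 * (d x - d y) \in Sset K.
  move=> xyU; have [k kK fxy] := fK y x.
  have Dk : (x - y)^-1 * (d x - d y) = k - 1.
    by apply: (mulrI xyU); rewrite mulVKr // mulrBr mulr1 -fxy /d; ring.
  have kI : k - 1 \in @I0 R by rewrite -Dk; apply/I0Ml/I0B; apply: fI.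
  by rewrite Dk inE kI addrCA subrr addr0.
have /affineP[s [c [sS dE]]] : affine d.
  apply: has_slopes_affine; split=> [|x y xym|]; [exact: fI | | exact: d_slope].
  (* For a unit [a], take [z] with [x - z = a^-1]. Then [y - z] has the same residue, and
     [a * (d x - d y)] is a difference of two slopes based at [z]. So all multiples of [d x - d y]
     lie in [Sset K]. *)
  apply/eqP; rewrite -subr_eq0; apply/eqP; apply: (pure_Sset K_pure) => a.
  have [aU | am] := boolP (a \is a GRing.unit); last first.
    by rewrite I0_mul0 ?Sset0 ?mem_rad //; apply: I0B; apply: fI.
  pose z := x - a^-1; pose w := y - z.
  have wE : w = a^-1 - (x - y) by rewrite /w /z; ring.
  have wU : w \is a GRing.unit by rewrite wE unit_rad_addr ?unitrV ?radN.
  have xz : x - z = a^-1 by rewrite /z; ring.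
  have -> : a * (d x - d y) = (x - z)^-1 * (d x - d z) - (y - z)^-1 * (d y - d z).
    rewrite xz invrK (@I0_mul_congr _ (y - z)^-1 a) -?/w; first by ring.
      have -> : w^-1 - a = w^-1 * (a * (x - y)).
        apply: (mulrI wU); rewrite mulVKr // mulrBr mulrV // wE mulrBl mulVr //; ring.
      by apply/radMl/radMl.
    by apply: I0B; apply: fI.
  by apply: SsetB; apply: d_slope; rewrite // xz unitrV.
have c0 : c = 0 by have := dE 0; rewrite /d f0 subrr mulr0 add0r.
have s0 : s = 0 by have := dE 1; rewrite /d f1 subrr mulr1 c0 addr0.
by move=> x; apply/eqP; rewrite -subr_eq0 -/(d x) dE s0 c0 mul0r addr0.
Qed.

End Slopes.

(** * Automorphisms of the scheme *)

Section Slopes.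
Variables (R : finComUnitRingType) (K : {group {unit R}}).
Implicit Types (x y z t s b c : R) (f : R -> R).
Local Notation m := (Defs.rad R).

(** Invariance of the relation with [r = y - x] gives the slope in [K]; conversely, slopes are
    absorbed by the group [K]. *)
Lemma cyc_autP f : cyc_aut (fun x => x \in Kset K) f <-> bijective f /\ K_slopes K f.
Proof.
split=> [[bij_f fK] | [bij_f fK]]; split=> //.
  move=> x y; have [] := (fK (y - x) x y).1; last by move=> k [kK ->]; exists k.
  by exists 1; rewrite Kset1 mulr1.
move=> r x y; split=> -[k [kK Dk]]; have [k' k'K Dk'] := fK x y.
  by exists (k * k'); rewrite KsetM // Dk' Dk mulrA.
exists (k * k'^-1); rewrite KsetM ?KsetV //; split=> //.
by rewrite mulrA -Dk Dk' mulrK ?(Kset_unit k'K).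
Qed.

Lemma K_slopes_comp f h : K_slopes K f -> K_slopes K h -> K_slopes K (f \o h).
Proof.
move=> fK hK x y; have [k kK Dk] := hK x y; have [k' k'K Dk'] := fK (h x) (h y).
by exists (k * k'); rewrite ?KsetM //= Dk' Dk mulrA.
Qed.

Lemma K_slopes_inv f h : K_slopes K f -> cancel h f -> K_slopes K h.
Proof.
move=> fK hK x y; have [k kK] := fK (h x) (h y); rewrite !hK => ->.
by exists k^-1; rewrite ?KsetV // mulrK // (Kset_unit kK).
Qed.

(** Slopes are units, so [f] preserves and reflects the relation [E_0]. *)
Lemma K_slopes_I0 f x y : K_slopes K f -> (f y - f x \in @I0 R) = (y - x \in @I0 R).
Proof.
move=> fK; have [k kK Dk] := fK x y; rewrite Dk.
apply/idP/idP=> [yxI | yxI]; last by rewrite mulrC; apply: I0Ml.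
by rewrite -[y - x](mulrK (Kset_unit kK)) mulrC; apply: I0Ml.
Qed.

Hypotheses (R_local : is_local R) (K_pure : pure K).

(** Rigidity applied to the inverse of [f] composed with [h]. *)
Lemma K_slopes_eq_mod_I0 f h : bijective f -> K_slopes K f -> K_slopes K h ->
  h 0 = f 0 -> h 1 = f 1 -> (forall x, h x - f x \in @I0 R) -> h =1 f.
Proof.
case=> f' f'K fK' fK hK h0 h1 hf x; apply: (can_inj fK'); rewrite f'K.
apply: (K_slopes_id_mod_I0 R_local K_pure (f := f' \o h)) => [||| y] /=.
- by apply: K_slopes_comp => //; apply: (K_slopes_inv fK fK').
- by rewrite h0 f'K.
- by rewrite h1 f'K.
by rewrite -(K_slopes_I0 _ _ fK) fK'.
Qed.

(** * Normalized automorphisms are ring automorphisms *)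

Section Normalized.
Variable f : R -> R.
Hypotheses (bij_f : bijective f) (fK : K_slopes K f) (f0 : f 0 = 0) (f1 : f 1 = 1).
Hypotheses (fD_I0 : forall x y, f (x + y) - (f x + f y) \in @I0 R)
  (fM_I0 : forall x y, f (x * y) - f x * f y \in @I0 R).

Lemma K_slopes_eqmul x : exists2 k, k \in Kset K & f x = x * k.
Proof. by have [k kK] := fK 0 x; rewrite f0 !subr0; exists k. Qed.

Lemma K_slopes_unitM u x : u \is a GRing.unit -> f (u * x) = f u * f x.
Proof.
move=> uU; have [k kK fu] := K_slopes_eqmul u; have kU := Kset_unit kK.
have fuU : f u \is a GRing.unit by rewrite fu unitrM uU.
apply: (mulrI (_ : (f u)^-1 \is a GRing.unit)); first by rewrite unitrV.
rewrite mulKr //; pose h y := (f u)^-1 * f (u * y); rewrite -/(h x).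
apply: (K_slopes_eq_mod_I0 (h := h) bij_f fK) => [y z|||y]; rewrite /h.
(* The factor [u] of [u * z - u * y] cancels against [f u = u * k], which leaves a slope in [K]. *)
- have [k' k'K Dk'] := fK (u * y) (u * z); exists (k^-1 * k'); first by rewrite KsetM ?KsetV.
  rewrite -mulrBr Dk'; apply: (mulrI fuU); rewrite mulVKr // fu.
  by rewrite -mulrBr -!mulrA; congr (_ * _); rewrite [RHS]mulrCA mulVKr.
- by rewrite mulr0 f0 mulr0.
- by rewrite mulr1 f1 mulVr.
have -> : (f u)^-1 * f (u * y) - f y = (f u)^-1 * (f (u * y) - f u * f y).
  by rewrite mulrBr mulKr.
exact: I0Ml.
Qed.

(* [f (x + b) - f b] is again normalized by a factor [1 + shift_defect b] of [K]. *)
Let shift_defect b := f (1 + b) - f b - 1.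

Lemma shift_defect_Sset b : shift_defect b \in Sset K.
Proof.
have [k kK Dk] := fK b (1 + b); rewrite inE; apply/andP; split.
  have -> : shift_defect b = f (1 + b) - (f 1 + f b) by rewrite f1 /shift_defect; ring.
  exact: fD_I0.
have -> : 1 + shift_defect b = k by rewrite /shift_defect Dk; ring.
exact: kK.
Qed.

Lemma K_slopes_shift b x : f (x + b) = f b + (1 + shift_defect b) * f x.
Proof.
have := shift_defect_Sset b; rewrite inE => /andP[eI cK]; have cU := Kset_unit cK.
pose h y := (1 + shift_defect b)^-1 * (f (y + b) - f b).
suff /(_ x) <- : h =1 f by rewrite mulVKr // addrCA subrr addr0.
apply: (K_slopes_eq_mod_I0 bij_f fK) => [y z|||y]; rewrite /h.
- have [k kK Dk] := fK (y + b) (z + b).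
  exists ((1 + shift_defect b)^-1 * k); first by rewrite KsetM ?KsetV.
  have -> : (1 + shift_defect b)^-1 * (f (z + b) - f b) - (1 + shift_defect b)^-1 * (f (y + b) - f b) =
      (1 + shift_defect b)^-1 * (f (z + b) - f (y + b)) by ring.
  by rewrite Dk; ring.
- by rewrite add0r subrr mulr0 f0.
- by rewrite f1 (_ : f (1 + b) - f b = 1 + shift_defect b) ?mulVr // /shift_defect; ring.
have -> : (1 + shift_defect b)^-1 * (f (y + b) - f b) - f y =
    (1 + shift_defect b)^-1 * ((f (y + b) - (f y + f b)) - f y * shift_defect b).
  apply: (mulrI cU); rewrite mulrBr !mulVKr //; ring.
by apply/I0Ml/I0B => //; apply: I0Ml.
Qed.

Lemma K_slopes_rad x : x \in m -> f x \in m.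
Proof. by move=> xm; have [k _ ->] := K_slopes_eqmul x; apply: radMr. Qed.

(** The defect lies in [I0] and annihilates [f x], which is in the radical. *)
Lemma K_slopes_add_rad x b : x \in m -> f (x + b) = f b + f x.
Proof.
move=> xm; rewrite K_slopes_shift mulrDl mul1r [shift_defect b * _]mulrC.
by rewrite (I0_mul0 (K_slopes_rad xm) (Sset_I0 (shift_defect_Sset b))) addr0.
Qed.

(** For [x] in the radical, expand the product of the unit [1 + x] and [y], using additivity on the
    radical. *)
Lemma K_slopesM x y : f (x * y) = f x * f y.
Proof.
have [xU | xm] := boolP (x \is a GRing.unit); first exact: K_slopes_unitM.
rewrite -(mem_rad R_local) in xm.
have xU : 1 + x \is a GRing.unit by rewrite unit_rad_addr ?unitr1.
have := K_slopes_unitM y xU; rewrite mulrDl mul1r addrC K_slopes_add_rad ?radMr //.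
by rewrite addrC [1 + x]addrC K_slopes_add_rad // f1 mulrDl mul1r => /(canRL (addrK _)) ->; ring.
Qed.

Lemma K_slopesX x k : f (x ^+ k) = f x ^+ k.
Proof. by elim: k => [|k IH]; rewrite ?expr0 // !exprS K_slopesM IH. Qed.

Lemma K_slopes_nat_I0 k : f k%:R - k%:R \in @I0 R.
Proof.
elim: k => [|k IH]; first by rewrite f0 subr0 I0_0.
have -> : f k.+1%:R - k.+1%:R = (f (k%:R + 1) - (f k%:R + f 1)) + (f k%:R - k%:R).
  by rewrite -natr1 f1; ring.
exact: I0D.
Qed.

Lemma K_slopes_sum_I0 k (F : 'I_k -> R) : f (\sum_i F i) - \sum_i f (F i) \in @I0 R.
Proof.
elim: k F => [|k IH] F; first by rewrite !big_ord0 f0 subr0 I0_0.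
rewrite !big_ord_recl; set A := F _; set B := \sum_i _; set C := \sum_i f _.
have -> : f (A + B) - (f A + C) = (f (A + B) - (f A + f B)) + (f B - C) by ring.
by apply: I0D; [exact: fD_I0 | exact: (IH (fun i => F (lift ord0 i)))].
Qed.

Lemma shift_defect_add_rad x b : x \in m -> shift_defect (b + x) = shift_defect b.
Proof.
move=> xm; rewrite /shift_defect (_ : 1 + (b + x) = x + (1 + b)); last by ring.
by rewrite [b + x]addrC (K_slopes_add_rad (1 + b) xm) (K_slopes_add_rad b xm); ring.
Qed.

Section ResidueChar.
Variables (p n : nat) (g : R).
Hypotheses (p_pr : prime p) (p_rad : (p%:R : R) \in m).
Local Notation W := (frob_defect p 1).

(** [a ^+ 2 = 0], and the mixed terms carry a factor [p], which annihilates [I0]. *)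
Lemma expr_addI0 z a : a \in @I0 R -> (z + a) ^+ p = z ^+ p.
Proof.
move=> aI; rewrite (exprD_frob_defect p_pr) (I0_mul0 p_rad) ?addr0.
  case: p p_pr => [|[|q]] // _.
  by rewrite [a ^+ _]exprS [a ^+ _]exprS mulrA (I0_mul0 (I0_rad aI) aI) mul0r addr0.
rewrite /frob_defect; elim/big_ind: _ => [|x y|i _]; [exact: I0_0 | exact: I0D |].
by rewrite exprSr mulrA; apply: I0Ml.
Qed.

Lemma K_slopes_frob_defect y : f (W y) - W (f y) \in @I0 R.
Proof.
rewrite /frob_defect; set S := \sum_i _; set S' := \sum_i _.
have -> : f S - S' = (f S - \sum_(i < p.-1) f (('C(p, i.+1) %/ p)%:R * 1 ^+ (p - i.+1) * y ^+ i.+1))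
   + (\sum_(i < p.-1) f (('C(p, i.+1) %/ p)%:R * 1 ^+ (p - i.+1) * y ^+ i.+1) - S') by ring.
apply: I0D; first exact: K_slopes_sum_I0.
rewrite -sumrB; elim/big_ind: _ => [|u v|i _]; [exact: I0_0 | exact: I0D |].
by rewrite !expr1n !mulr1 K_slopesM K_slopesX -mulrBl mulrC; apply: I0Ml; apply: K_slopes_nat_I0.
Qed.

Local Notation char_defect := (p%:R - f p%:R).

Lemma char_defect_I0 : char_defect \in @I0 R.
Proof. by rewrite -opprB; apply: I0N; apply: K_slopes_nat_I0. Qed.

(* Compare the values of [f] on [(1 + y) ^+ p = 1 + y ^+ p + p%:R * W y]. *)
Lemma shift_defect_expr y : shift_defect (y ^+ p) = char_defect * W (f y).
Proof.
have f1D z : f (1 + z) = 1 + f z + shift_defect z by rewrite /shift_defect; ring.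
(* The summand [p%:R * W y] is in the radical, so it splits off exactly; in [E2] the defect at [y]
   disappears under the [p]-th power. *)
have E1 : f ((1 + y) ^+ p) = 1 + f y ^+ p + shift_defect (y ^+ p) + f p%:R * f (W y).
  by rewrite (exprD_frob_defect p_pr) expr1n [_ + p%:R * _]addrC K_slopes_add_rad ?radMr // f1D K_slopesX K_slopesM.
have E2 : f ((1 + y) ^+ p) = 1 + f y ^+ p + p%:R * W (f y).
  by rewrite K_slopesX f1D expr_addI0 ?(Sset_I0 (shift_defect_Sset y)) // (exprD_frob_defect p_pr) expr1n.
have -> : char_defect * W (f y) = char_defect * f (W y).
  rewrite ![char_defect * _]mulrC; apply/esym/I0_mul_congr; last exact: char_defect_I0.
  by apply: I0_rad; apply: K_slopes_frob_defect.
have pW : p%:R * f (W y) = p%:R * W (f y).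
  apply/eqP; rewrite -subr_eq0 -mulrBr; apply/eqP/I0_mul0 => //; exact: K_slopes_frob_defect.
apply: (addrI (1 + f y ^+ p)); apply: (addIr (f p%:R * f (W y))).
by rewrite -E1 E2 mulrBl pW; ring.
Qed.

Hypotheses (n_gt0 : (0 < n)%N) (frobn : forall x, x ^+ (p ^ n) - x \in m).
Local Notation N := (p ^ n).-1.
Local Notation h := (g ^+ N.-1).
Hypotheses (gN : g ^+ N = 1)
  (gU : forall j, ~~ (N %| j)%N -> g ^+ j - 1 \is a GRing.unit).

(** The condition is [i + 1 = p ^ s] modulo [N]. If [s > 0], then [i + 1 < p ^ s < p ^ n], and the
    positive difference is too small to be a multiple of [N]. *)
Lemma dvdn_defect_exponent (i s : nat) : (i < p.-1)%N -> (s < n)%N ->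
  (N %| i.+1 + N.-1 * p ^ s)%N = (s == 0%N) && (i == 0%N).
Proof.
move=> ip sn; rewrite (dvdn_addr_mul_pred p_pr n_gt0).
have p_gt1 := prime_gt1 p_pr.
have pn : (p <= p ^ n)%N by rewrite -{1}(expn1 p) leq_pexp2l // ltnW.
case: s sn => [|s] sn /=.
  rewrite expn0 -add1n -[X in _ == X %[mod _]]addn0 eqn_modDl mod0n modn_small //.
  by apply: leq_trans ip _; rewrite -!subn1 leq_sub2r.
have ps : (p <= p ^ s.+1)%N by rewrite -{1}(expn1 p) leq_pexp2l // ltnW.
have psn : (p ^ s.+1 < p ^ n)%N by rewrite ltn_exp2l.
have ips : (i.+1 < p ^ s.+1)%N by apply: leq_trans ps; rewrite -ltn_predRL.
rewrite eq_sym eqn_mod_dvd ?(ltnW ips) //; apply: gtnNdvd; first by rewrite subn_gt0.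
by move: ips psn; move: (p ^ s.+1)%N (p ^ n)%N => A B; lia.
Qed.

Lemma char_defect_eq0 : char_defect = 0.
Proof.
(* Surjectivity of [f] makes its values arbitrary arguments of [W]. *)
have WS z : char_defect * W z \in Sset K.
  have [f' _ f'K] := bij_f; rewrite -[z]f'K -shift_defect_expr; exact: shift_defect_Sset.
apply: (pure_Sset K_pure) => c; rewrite -[_ * _]opprK; apply: SsetN.
have p1 : (0 < p.-1)%N by rewrite -subn1 subn_gt0 prime_gt1.
(* Pairing with the traces of [c * h ^+ l] isolates the linear term of [W], whose coefficient
   ['C(p, 1) %/ p] is 1. *)
suff <- : \sum_(l < N) frob_trace p n (c * h ^+ l) * (char_defect * W (g ^+ l)) = - (c * char_defect).
  by apply: Sset_sum => l; apply: (Sset_frob_trace R_local p_pr p_rad n_gt0 frobn).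
pose B (i : nat) : R := ('C(p, i.+1) %/ p)%:R.
have -> : \sum_(l < N) frob_trace p n (c * h ^+ l) * (char_defect * W (g ^+ l)) =
    \sum_(s < n) \sum_(i < p.-1) (c ^+ (p ^ s) * char_defect * B i) *
       \sum_(l < N) g ^+ (l * (i.+1 + N.-1 * p ^ s)).
  under eq_bigr => l _ do rewrite mulr_suml.
  rewrite exchange_big; apply: eq_bigr => s _ /=.
  under eq_bigr => l _ do rewrite !mulr_sumr.
  rewrite exchange_big; apply: eq_bigr => i _ /=.
  rewrite mulr_sumr; apply: eq_bigr => l _.
  have -> : g ^+ (l * (i.+1 + N.-1 * p ^ s)) = (h ^+ l) ^+ (p ^ s) * (g ^+ l) ^+ i.+1.
    rewrite -!exprM -exprD; congr (_ ^+ _); ring.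
  by rewrite expr1n exprMn /B; ring.
have ordE (s i : nat) : (s < n)%N -> (i < p.-1)%N ->
    \sum_(l < N) g ^+ (l * (i.+1 + N.-1 * p ^ s)) =
    if (s == 0%N) && (i == 0%N) then N%:R else 0.
  by move=> sn ip; rewrite (sum_teichmuller_expr gN gU) dvdn_defect_exponent.
rewrite (bigD1 (Ordinal n_gt0)) //= [X in _ + X]big1 => [|s s0]; last first.
  have {}s0 : (s == 0 :> nat)%N = false by apply: negbTE.
  by apply: big1 => i _; rewrite ordE // s0 mulr0.
rewrite addr0 (bigD1 (Ordinal p1)) //= [X in _ + X]big1 => [|i i0]; last first.
  have {}i0 : (i == 0 :> nat)%N = false by apply: negbTE.
  by rewrite ordE // i0 andbF mulr0.
rewrite addr0 ordE // !eqxx /B bin1 divnn prime_gt0 // mulr1 expn0 expr1 mulrC.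
by rewrite (teichmuller_card_I0 p_pr p_rad n_gt0) //; apply/I0Ml/char_defect_I0.
Qed.

(** Modulo the radical [b] is the [p]-th power of [b ^+ (p ^ n.-1)], and the defect depends only on
    the residue. *)
Lemma shift_defect_eq0 b : shift_defect b = 0.
Proof.
have be : (b ^+ (p ^ n.-1)) ^+ p - b \in m by rewrite -exprM -expnSr prednK.
rewrite -[b](addrNK ((b ^+ (p ^ n.-1)) ^+ p)) addrC shift_defect_add_rad; last by rewrite -opprB radN.
by rewrite shift_defect_expr char_defect_eq0 mul0r.
Qed.

End ResidueChar.

Lemma K_slopes_ring_aut : ring_aut f.
Proof.
split=> //; last exact: K_slopesM.
have [p [n [g [[p_pr n_gt0] p_rad gN gU frobn]]]] := teichmuller_exists R_local.
move=> x y; rewrite K_slopes_shift (shift_defect_eq0 p_pr p_rad n_gt0 frobn gN gU).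
by rewrite addr0 mul1r addrC.
Qed.

End Normalized.
End Slopes.

(** * The induced maps on [R/I_0] *)

Section Quotient.
Variables (R : finComUnitRingType) (K : {group {unit R}}).
Implicit Types (x y : R) (q : quotI0 R) (f : R -> R).

Lemma pi0_eq x y : pi0 x = pi0 y <-> x - y \in @I0 R.
Proof. by rewrite Quotient.idealrBE; split=> [xy|/eqP //]; exact/eqP. Qed.

Lemma pi0D x y : pi0 (x + y) = pi0 x + pi0 y.
Proof. exact: rmorphD. Qed.

Lemma pi0B x y : pi0 (x - y) = pi0 x - pi0 y.
Proof. exact: rmorphB. Qed.

Lemma pi0M x y : pi0 (x * y) = pi0 x * pi0 y.
Proof. exact: rmorphM. Qed.

Lemma pi0_0 : pi0 (0 : R) = 0.
Proof. exact: rmorph0. Qed.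

Lemma pi0_1 : pi0 (1 : R) = 1.
Proof. exact: rmorph1. Qed.

Lemma pi0_repr q : pi0 (repr q) = q.
Proof. exact: reprK. Qed.

Lemma induced_pi0 f x : K_slopes K f -> induced f (pi0 x) = pi0 (f x).
Proof.
by move=> fK; apply/pi0_eq; rewrite (K_slopes_I0 _ _ fK); apply/pi0_eq; rewrite pi0_repr.
Qed.

Lemma induced_bij f : bijective f -> K_slopes K f -> bijective (induced f).
Proof.
case=> f' f'K fK' fK; have f'slopes := K_slopes_inv fK fK'.
by exists (induced f') => q; rewrite -[q]pi0_repr !induced_pi0 // ?f'K ?fK'.
Qed.

Lemma induced_cyc_rel f r a b : K_slopes K f -> cyc_rel (KquotI0 K) r a b ->
  cyc_rel (KquotI0 K) r (induced f a) (induced f b).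
Proof.
move=> fK [_ [[k [kK ->]] ab]].
(* The lift [y] of [b] is chosen so that [y - x] is exactly a multiple of [repr r] by an element of
   [K]. *)
pose x := repr a; pose y := x + repr r * k.
have yb : pi0 y = b by rewrite pi0D pi0M !pi0_repr -ab addrC subrK.
have [k' k'K Dk'] := fK x y.
exists (pi0 (k * k')); split; first by exists (k * k'); rewrite KsetM.
rewrite -yb -[a]pi0_repr !(induced_pi0 _ fK) -pi0B Dk' -[r in RHS]pi0_repr -pi0M.
by rewrite /y addrAC subrr add0r mulrA.
Qed.

Lemma induced_cyc_aut f : bijective f -> K_slopes K f -> cyc_aut (KquotI0 K) (induced f).
Proof.
move=> bij_f fK; split; first exact: induced_bij.
move=> r a b; split; first exact: induced_cyc_rel.
have [f' f'K fK'] := bij_f; have f'slopes := K_slopes_inv fK fK'.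
have iK q : induced f' (induced f q) = q.
  by rewrite -[q]pi0_repr (induced_pi0 _ fK) (induced_pi0 _ f'slopes) f'K.
by move/(induced_cyc_rel f'slopes); rewrite !iK.
Qed.

Lemma induced_ring_aut f : K_slopes K f -> ring_aut f -> ring_aut (induced f).
Proof.
move=> fK [bij_f fD fM f1]; split; first exact: induced_bij.
- by move=> a b; rewrite -[a]pi0_repr -[b]pi0_repr -pi0D !(induced_pi0 _ fK) fD pi0D.
- by move=> a b; rewrite -[a]pi0_repr -[b]pi0_repr -pi0M !(induced_pi0 _ fK) fM pi0M.
by rewrite -{1}pi0_1 (induced_pi0 _ fK) f1 pi0_1.
Qed.

End Quotient.

Theorem theorem6p1 (R : finComUnitRingType) (K : {group {unit R}}) :
  is_local R -> pure K ->
  (* the natural mapping Aut_C(R) -> Aut_C(R/I_0) is well defined ... *)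
  (forall s : R -> R, cyc_ring_aut (fun x => x \in Kset K) s ->
     cyc_ring_aut (KquotI0 K) (induced s) /\
     (forall x : R, induced s (@pi0 R x) = @pi0 R (s x))) /\
  (* ... and injective (it is a monomorphism) *)
  (forall s t : R -> R,
     cyc_ring_aut (fun x => x \in Kset K) s ->
     cyc_ring_aut (fun x => x \in Kset K) t ->
     (forall q : quotI0 R, induced s q = induced t q) -> s =1 t) /\
  (* Aut(C)^{R/E_0} <= AGammaL_1(R/I_0) implies Aut(C) <= AGammaL_1(R) *)
  ((forall f : R -> R, cyc_aut (fun x => x \in Kset K) f -> in_AGammaL1 (induced f)) ->
   forall f : R -> R, cyc_aut (fun x => x \in Kset K) f -> in_AGammaL1 f).
Proof.
move=> R_local K_pure; split; [|split].
- move=> s [/cyc_autP[bij_s sK] s_aut]; split; last by move=> x; apply: induced_pi0 sK.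
  by split; [exact: induced_cyc_aut | exact: induced_ring_aut s_aut].
- move=> s t [/cyc_autP[_ sK] [_ sD _ s1]] [/cyc_autP[bij_t tK] [_ tD _ t1]] st.
  have zero (h : R -> R) : (forall x y, h (x + y) = h x + h y) -> h 0 = 0.
    by move=> hD; apply: (addrI (h 0)); rewrite -hD !addr0.
  apply: (K_slopes_eq_mod_I0 R_local K_pure bij_t tK sK) => [||x].
  + by rewrite !zero.
  + by rewrite s1 t1.
  by apply/pi0_eq; rewrite -(induced_pi0 _ sK) -(induced_pi0 _ tK).
move=> AGL f /cyc_autP[[f' f'K fK'] fK].
have [k kK] := fK 0 1; rewrite subr0 mul1r => Dk; have kU := Kset_unit kK.
pose h x := k^-1 * (f x - f 0).
have hK : K_slopes K h.
  move=> x y; have [k' k'K Dk'] := fK x y; exists (k^-1 * k'); first by rewrite KsetM ?KsetV.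
  by rewrite -mulrBr opprB addrA subrK Dk' mulrCA.
have bij_h : bijective h.
  exists (fun x => f' (k * x + f 0)) => x; rewrite /h; last by rewrite fK' addrK mulKr.
  by rewrite mulVKr // subrK f'K.
have h0 : h 0 = 0 by rewrite /h subrr mulr0.
have h1 : h 1 = 1 by rewrite /h Dk mulVr.
(* The hypothesis is applied to [h], not to [f]: as [h] fixes 0 and 1, its induced map is the ring
   automorphism [sg] itself. *)
have [a [b [sg [[a' aa'] [_ sgD sgM sg1] hE]]]] := AGL h ((cyc_autP K h).2 (conj bij_h hK)).
have sg0 : sg 0 = 0 by apply: (addrI (sg 0)); rewrite -sgD !addr0.
have b0 : b = 0 by have := hE 0; rewrite -[in LHS]pi0_0 (induced_pi0 _ hK) h0 pi0_0 sg0 mulr0 add0r.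
have a1 : a = 1 by have := hE 1; rewrite -[in LHS]pi0_1 (induced_pi0 _ hK) h1 pi0_1 sg1 mulr1 b0 addr0.
have pi0h x : pi0 (h x) = sg (pi0 x) by rewrite -(induced_pi0 _ hK) hE a1 b0 mul1r addr0.
have h_aut : ring_aut h.
  apply: (K_slopes_ring_aut R_local K_pure bij_h hK h0 h1) => x y; apply/pi0_eq.
    by rewrite pi0D !pi0h pi0D sgD.
  by rewrite pi0M !pi0h pi0M sgM.
exists k, (f 0), h; split=> [|//|x]; first by exists k^-1; rewrite mulrV.
by rewrite /h mulVKr // subrK.
Qed.
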